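(* The following two assertions are equivalent: (a) every 4-edge-connected graph admits a nowhere-zero 3-flow; (b) every 5-edge-connected graph with minimum degree at least $6$ has a nowhere-zero 3-flow.
   Context: Graphs are finite and loopless, but may have multiple edges. A graph $G$ is $k$-edge-connected if $G-S$ is connected for each edge set $S$ with $|S|<k$. For an orientation $D$ of $E(G)$ and a vertex $v$, $\partial_D^+(v)$ (resp. $\partial_D^-(v)$) is the set of arcs with tail (resp. head) $v$. A graph $G$ admits (has) a nowhere-zero 3-flow if there are an orientation $D$ of $E(G)$ and a function $f:E(G)\to\{\pm1,\pm2\}$ such that $\sum_{e\in\partial_D^+(v)}f(e)=\sum_{e\in\partial_D^-(v)}f(e)$ for every $v\in V(G)$. *)

(* Defs.v *)
From HB Require Import structures.
From mathcomp Require Import all_boot all_order all_algebra.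
Set Implicit Arguments.
Unset Strict Implicit.
Unset Printing Implicit Defensive.
Import Order.TTheory GRing.Theory Num.Theory.

(* Edges have their own type, so parallel edges are allowed; [loopless] says
   that the (unordered) ends of an edge are two distinct vertices. *)
Record multigraph := MultiGraph {
  vertex : finType;
  edge : finType;
  ends : edge -> {set vertex};
  loopless : forall e, #|ends e| = 2
}.

Definition adjacent (G : multigraph) : rel (vertex G) :=
  fun x y => [exists e : edge G, ends e == [set x; y]].

(* The graph without vertices is not considered connected. *)
Definition connected (G : multigraph) : Prop :=
  0 < #|vertex G| /\ forall x y : vertex G, connect (@adjacent G) x y.

Definition delete_edges (G : multigraph) (S : {set edge G}) : multigraph :=
  @MultiGraph (vertex G) {e : edge G | e \notin S}
    (fun e => ends (val e)) (fun e => loopless (val e)).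

Definition edge_connected (k : nat) (G : multigraph) : Prop :=
  forall S : {set edge G}, #|S| < k -> connected (delete_edges S).

Definition degree (G : multigraph) (v : vertex G) : nat :=
  #|[set e : edge G | v \in ends e]|.

Definition min_degree_ge (d : nat) (G : multigraph) : Prop :=
  forall v : vertex G, d <= degree v.

Record orientation (G : multigraph) := Orientation {
  tail : edge G -> vertex G;
  head : edge G -> vertex G;
  orientation_ends : forall e, ends e = [set tail e; head e]
}.

Definition out_arcs (G : multigraph) (D : orientation G) (v : vertex G) :
  {set edge G} := [set e | tail D e == v].

Definition in_arcs (G : multigraph) (D : orientation G) (v : vertex G) :
  {set edge G} := [set e | head D e == v].

Definition has_nowhere_zero_3flow (G : multigraph) : Prop :=
  exists (D : orientation G) (f : edge G -> int),
    (forall e, f e \in [:: 1; -1; 2; -2]%R) /\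
    (forall v, (\sum_(e in out_arcs D v) f e = \sum_(e in in_arcs D v) f e)%R).

(* Main.v *)
Require Import Defs.
From HB Require Import structures.
From mathcomp Require Import all_boot all_order all_algebra.
From mathcomp Require Import zify ring.
Set Implicit Arguments.
Unset Strict Implicit.
Unset Printing Implicit Defensive.

(** The statement for 5-edge-connected graphs is a special case of the one for
4-edge-connected graphs.  The converse goes through Tutte's observation that a
graph has a nowhere-zero 3-flow exactly when it has an orientation whose
out-degree and in-degree agree modulo 3 at every vertex
([nowhere_zero_3flowP], whose substance is [integral_lift]), so the rest
of the proof only deals with such modulo 3 orientations.  They are studied on
digraphs [a, b : E -> V] in which loops are allowed: loops change neither cuts
nor conservation, so contracting a set is just composing the end maps with a
map.

Minimum degree 6 is no restriction: joining every vertex to a new vertex of its own by 6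
parallel edges keeps a graph 5-edge-connected, and the 6 new edges carry no net
flow ([orientable3_of_5_6]).  It remains to go from edge-connectivity 5 to 4
([orientable3_of_5]).

Take a 4-edge-connected graph G with as few vertices as possible among those
without a modulo 3 orientation; it has a 4-edge cut, and X is taken to be a
smallest nonempty proper vertex set joined to its complement by exactly 4 edges.  If X is a
single vertex, then the four edges at it can be paired and each pair replaced by
one edge so that the graph stays 4-edge-connected ([degree4_reduction]); an
orientation of this smaller graph gives one of G.  Otherwise G/X is smaller,
hence oriented, and two of the four cut edges, h1 and h2, leave X while the
other two, h3 and h4, enter it.  An orientation that is balanced inside X and
has this pattern on the cut could be glued to that of G/X, so inside X the
pattern h1 = h2 <> h3 = h4 is impossible.

This forbidden pattern yields a 5-edge-connected graph without modulo 3
orientation.  Give the end of h4 in X a second pendant edge.  Now X has five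
outgoing edges, whose signs split 4 to 1, and h3 is not the minority edge: if it
were, the two edges at the end of h4 could be traded for a single one of the
opposite sign, and the forbidden pattern would appear.  Take five copies of X,
send the h3 edge of each to one new vertex, and join the remaining four edges of
each copy to the four other copies, as in the complete graph on 6 vertices.  In
each copy the net outflow is thus three times the sign of its h3 edge.  The
edges between copies cancel in the sum of these outflows, so the sum of the five
h3 signs equals three times itself; but five signs never sum to zero
([pentagon_not_orientable]).  The new graph is 5-edge-connected by the
minimality of X ([pentagon_connected]). *)

Section ModuloThree.
Import Order.TTheory GRing.Theory Num.Theory.
Local Open Scope ring_scope.

(** * Modulo 3 orientations and integral flows *)

(** The net outflow of [f] at [v]; a loop contributes 0, as its two terms cancel. *)
Definition netflow (V E : finType) (a b : E -> V) (f : E -> int) (v : V) : int :=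
  \sum_e f e * ((a e == v)%:Z - (b e == v)%:Z).

Definition sgn (s : bool) : int := if s then 1 else -1.

(** Reversing the edges where [s] is false gives an orientation whose out-degree and
in-degree agree modulo 3 at every vertex; [s] is kept separate from the end maps so
that these can stay fixed. *)
Definition orientable3 (V E : finType) (a b : E -> V) : Prop :=
  exists s : E -> bool, forall v, (3 %| netflow a b (fun e => sgn (s e)) v)%Z.

Definition cut (V E : finType) (a b : E -> V) (S : {set V}) : nat :=
  (\sum_e ((a e \in S) != (b e \in S)))%N.

Definition cut_connected k (V E : finType) (a b : E -> V) : Prop :=
  (0 < #|V|)%N /\
  forall S : {set V}, S != set0 -> S != setT -> (k <= cut a b S)%N.

Lemma sum_delta (V : finType) (X : {set V}) (x : V) :
  \sum_(v in X) (x == v)%:Z = (x \in X)%:Z.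
Proof.
have [xX|xX] := boolP (x \in X).
  rewrite (bigD1 x xX) /= eqxx big1 ?addr0 // => v /andP[_ nvx].
  by rewrite eq_sym (negbTE nvx).
rewrite big1 // => v vX; case: eqP => // xv.
by rewrite xv vX in xX.
Qed.

Lemma sum_netflow (V E : finType) (a b : E -> V) f (X : {set V}) :
  \sum_(v in X) netflow a b f v = \sum_e f e * ((a e \in X)%:Z - (b e \in X)%:Z).
Proof.
rewrite /netflow exchange_big /=; apply: eq_bigr => e _.
by rewrite -mulr_sumr sumrB !sum_delta.
Qed.

Section Lifting.
Variables (V E : finType) (a b : E -> V).

(** The two values congruent to 1 modulo 3 that a 3-flow may take on an edge. *)
Definition lift_value (r : E -> bool) (e : E) : int := if r e then -2 else 1.

Definition excess (r : E -> bool) (v : V) : int := netflow a b (lift_value r) v.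

Definition total_excess (r : E -> bool) : nat := (\sum_v `|excess r v|)%N.

(** One can move 3 units of excess from [x] to [y] by switching the value of an edge. *)
Definition residual (r : E -> bool) : rel V := fun x y =>
  [exists e, if r e then (b e == x) && (a e == y) else (a e == x) && (b e == y)].

Hypothesis div3 : forall v, (3 %| netflow a b (fun=> 1%R) v)%Z.

Lemma dvd_excess r v : (3 %| excess r v)%Z.
Proof.
have -> : excess r v = netflow a b (fun=> 1) v
    + 3 * \sum_e (- (r e)%:Z) * ((a e == v)%:Z - (b e == v)%:Z).
  rewrite /excess /netflow mulr_sumr -big_split /=; apply: eq_bigr => e _.
  by rewrite /lift_value; case: (r e) => /=; lia.
have := div3 v; lia.
Qed.

Lemma excess_flip r e v :
  excess (fun e' => if e' == e then ~~ r e else r e') v =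
  excess r v + (if r e then 3 else -3) * ((a e == v)%:Z - (b e == v)%:Z).
Proof.
rewrite /excess /netflow (bigD1 e) //= [X in _ = X + _](bigD1 e) //=.
rewrite [X in _ + X = _](eq_bigr (fun i => lift_value r i * ((a i == v)%:Z - (b i == v)%:Z))).
  by rewrite /lift_value eqxx; move: (\sum_(_ | _) _) (_ - _) => A B; case: (r e) => /=; ring.
by move=> i /negbTE; rewrite /lift_value => ->.
Qed.

(** Switching all edges of the path would move 3 units of excess from its first to its
last vertex.  Switching only the first edge and recursing is easier: either
the second vertex has a negative excess, and the total drops at once, or it
becomes positive, at no cost, and the shorter path starts there. *)
Lemma augment p : forall x r, path (residual r) x p -> uniq (x :: p) ->
  0 < excess r x -> excess r (last x p) < 0 ->
  exists r' : E -> bool, (total_excess r' < total_excess r)%N.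
Proof.
elim: p => [|y p IH] x r; first by move=> _ _ /=; lia.
move=> /= /andP[/existsP[e He] pth] /andP[xp up] ex_pos el_neg.
pose r' e' := if e' == e then ~~ r e else r e'.
have xy : x != y by move: xp; rewrite inE negb_or; case/andP.
have exr v : excess r' v = excess r v - 3 * (x == v)%:Z + 3 * (y == v)%:Z.
  rewrite excess_flip; move: He; case: (r e) => /andP[/eqP <- /eqP <-]; lia.
have dx := dvd_excess r x; have dy := dvd_excess r y.
have totE : (total_excess r' + (absz (excess r x) + absz (excess r y)) =
    total_excess r + (absz (excess r x - 3)%R + absz (excess r y + 3)%R))%N.
  have yx : y != x by rewrite eq_sym.
  rewrite /total_excess (bigD1 x) //= (bigD1 y) //=.
  rewrite [X in _ = (X + _)%N](bigD1 x) //= (bigD1 (P := fun i => i != x) y) //=.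
  rewrite (eq_bigr (fun i => absz (excess r i))).
    rewrite !exr !eqxx (eq_sym y x) (negbTE xy); lia.
  move=> i /andP[/negbTE ix /negbTE iy].
  by rewrite exr (eq_sym x) (eq_sym y) ix iy; congr absz; lia.
have [ey|ey] := ltP (excess r y) 0.
  by exists r'; lia.
have [] := IH y r'.
(* The switched edge meets [x], which the rest of the path avoids. *)
- apply: (@sub_in_path _ [in y :: p] _ _ _ y p _ pth); last by apply/allP.
  move=> u w.
  have step z : z \in y :: p -> z != x by apply: contraTneq => ->.
  move=> /step ux /step wx /existsP[e1 He1]; apply/existsP; exists e1.
  rewrite /r'; case: eqP => // e1e; subst e1.
  move: He He1; case: (r e) => /andP[/eqP aE /eqP bE] /andP[/eqP aE' /eqP bE'].
    by rewrite -aE' aE eqxx in ux.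
  by rewrite -aE' aE eqxx in ux.
- exact: up.
- by rewrite exr eqxx (negbTE xy); lia.
- have lx : x != last y p.
    by apply: contraNneq xp => ->; exact: mem_last.
  have ly : y != last y p.
    by apply: contraTneq el_neg => <-; rewrite -leNgt.
  by rewrite exr (negbTE lx) (negbTE ly); lia.
move=> r2 lt2; exists r2; apply: leq_trans lt2 _; lia.
Qed.

(** Tutte's passage from modulo 3 flows to integral ones: choose the values 1 and -2 so
that the total excess is smallest.  If some vertex [v] has a positive excess, let [S]
be the set of vertices reachable from [v] in the residual relation.  Edges leaving [S]
have value -2 and edges entering it have value 1, so the excess of [S] is at most 0,
some vertex of [S] has a negative excess, and a path to it decreases the total. *)
Lemma integral_lift : exists r : E -> bool, forall v, excess r v = 0.
Proof.
pose F (r : {ffun E -> bool}) := total_excess r.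
case: (arg_minnP (P := xpredT) F (i0 := [ffun=> false]) isT) => r _ rmin.
exists r => v; apply/eqP; move: v; apply/forallP; apply/negPn/negP.
rewrite negb_forall => /existsP[v0 v0P].
have tot0 : \sum_v excess r v = 0.
  have := sum_netflow a b (lift_value r) setT.
  rewrite (eq_bigl xpredT) => [|v]; last by rewrite inE.
  by rewrite /excess => ->; rewrite big1 // => e _; rewrite !inE subrr mulr0.
have [v v_pos] : exists v, 0 < excess r v.
  apply/existsP; apply: contraT; rewrite negb_exists => /forallP npos.
  have le0 u : excess r u <= 0 by rewrite leNgt npos.
  have : \sum_(v | v != v0) excess r v <= 0 by apply: sumr_le0 => u _.
  move: tot0 v0P (le0 v0); rewrite (bigD1 v0) //=.
  by move: (excess r v0) (\sum_(_ | _) _) => A B; lia.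
pose S := [set u | connect (residual r) v u].
have closed e : if r e then (b e \in S) ==> (a e \in S) else (a e \in S) ==> (b e \in S).
  have st x y : residual r x y -> (x \in S) ==> (y \in S).
    by move=> xy; apply/implyP; rewrite !inE => /connect_trans; apply; apply: connect1.
  case re: (r e); apply: st; apply/existsP; exists e; by rewrite re !eqxx.
have Sle : \sum_(u in S) excess r u <= 0.
  rewrite sum_netflow; apply: sumr_le0 => e _; rewrite /lift_value.
  by have := closed e; case: (r e); case: (a e \in S); case: (b e \in S).
have vS : v \in S by rewrite inE connect0.
have [w wS w_neg] : exists2 w, w \in S & excess r w < 0.
  apply/exists_inP; apply: contraT; rewrite negb_exists_in => /forall_inP nneg.
  have : 0 <= \sum_(u in S | u != v) excess r u.
    by apply: sumr_ge0 => u /andP[/nneg]; rewrite -leNgt.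
  move: Sle v_pos; rewrite (bigD1 v) //=.
  by move: (excess r v) (\sum_(_ | _) _) => A B; lia.
move: wS; rewrite inE => /connectP[p pth lw].
move: w_neg; rewrite lw; case/shortenP: pth => q qpth qu _ lneg.
have [r' lt'] := augment qpth qu v_pos lneg.
have := rmin [ffun e => r' e] isT; rewrite leqNgt; case/negP.
apply: leq_trans lt'; rewrite /F ltnS; apply: leq_sum => u _.
suff -> : excess [ffun e => r' e] u = excess r' u by [].
by apply: eq_bigr => e _; rewrite /lift_value ffunE.
Qed.

End Lifting.

(** * Multigraphs and digraphs *)

(** Both pairs of maps describe the same undirected edges. *)
Definition reorients (V E : finType) (a b a' b' : E -> V) : Prop :=
  forall e, (a' e = a e /\ b' e = b e) \/ (a' e = b e /\ b' e = a e).

Lemma orientable3_reorients (V E : finType) (a b a' b' : E -> V) :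
  reorients a b a' b' -> orientable3 a b -> orientable3 a' b'.
Proof.
move=> ab [s sP]; exists (fun e => if (a' e == a e) && (b' e == b e) then s e else ~~ s e) => v.
suff -> : netflow a' b' (fun e => sgn (if (a' e == a e) && (b' e == b e) then s e else ~~ s e)) v
        = netflow a b (fun e => sgn (s e)) v by [].
apply: eq_bigr => e _; case: (ab e) => -[-> ->]; first by rewrite !eqxx.
case: ifP => [/andP[/eqP-> _]|_] //.
by case: (s e) => /=; rewrite /sgn /=; ring.
Qed.

Lemma cut_reorients (V E : finType) (a b a' b' : E -> V) S :
  reorients a b a' b' -> cut a' b' S = cut a b S.
Proof.
by move=> ab; apply: eq_bigr => e _; case: (ab e) => -[-> ->] //; rewrite eq_sym.
Qed.

Lemma cut_setC (V E : finType) (a b : E -> V) S : cut a b (~: S) = cut a b S.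
Proof.
apply: eq_bigr => e _; rewrite !inE.
by case: (a e \in S); case: (b e \in S).
Qed.

Lemma set2_eq (V : finType) (x y z t : V) : [set x; y] = [set z; t] ->
  (z = x /\ t = y) \/ (z = y /\ t = x).
Proof.
move=> e.
have /set2P zP : z \in [set x; y] by rewrite e !inE eqxx.
have /set2P tP : t \in [set x; y] by rewrite e !inE eqxx orbT.
have /set2P xP : x \in [set z; t] by rewrite -e !inE eqxx.
have /set2P yP : y \in [set z; t] by rewrite -e !inE eqxx orbT.
by case: zP tP xP yP => -> [] -> [] ? [] ?; subst; auto.
Qed.

Lemma orientations_reorient (G : multigraph) (D D' : orientation G) :
  reorients (tail D) (Defs.head D) (tail D') (Defs.head D').
Proof. by move=> e; apply: set2_eq; rewrite -!orientation_ends. Qed.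

Lemma orientation_exists (G : multigraph) : inhabited (orientation G).
Proof.
have ends_pair (e : edge G) : {p | ends e == [set p.1; p.2]}.
  apply: sigW; have /eqP/cards2P[x [y [_ xy]]] := loopless e.
  by exists (x, y); apply/eqP.
constructor; apply: (@Orientation G (fun e => (sval (ends_pair e)).1)
  (fun e => (sval (ends_pair e)).2)) => e.
exact/eqP/(svalP (ends_pair e)).
Qed.

(** An edge value of a 3-flow is congruent modulo 3 to 1 or to -1, which is the sign of the
edge in the orientation.  Conversely, reverse the edges with a negative sign and apply
[integral_lift]. *)
Lemma nowhere_zero_3flowP (G : multigraph) (D : orientation G) :
  has_nowhere_zero_3flow G <-> orientable3 (tail D) (Defs.head D).
Proof.
split=> [[D' [f [fP conserved]]]|[s sP]].
  apply: (orientable3_reorients (orientations_reorient D' D)).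
  exists (fun e => (f e == 1) || (f e == -2)) => v.
  (* [k] is the quotient by 3 in the congruence between a value and its sign. *)
  pose k e := if (f e == 1) || (f e == -1) then 0 else if f e == 2 then 1 else -1 : int.
  have -> : netflow (tail D') (Defs.head D') (fun e => sgn ((f e == 1) || (f e == -2))) v =
     netflow (tail D') (Defs.head D') f v - 3 * netflow (tail D') (Defs.head D') k v.
    rewrite /netflow mulr_sumr -sumrB; apply: eq_bigr => e _.
    have := fP e; rewrite !inE /k => /or4P[] /eqP -> /=; rewrite /sgn /=; ring.
  have -> : netflow (tail D') (Defs.head D') f v = 0; last by lia.
  have := conserved v; rewrite /out_arcs /in_arcs.
  rewrite big_mkcond [X in _ = X]big_mkcond /=.
  move/eqP; rewrite -subr_eq0 -sumrB => /eqP zero; rewrite -[RHS]zero.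
  apply: eq_bigr => e _; rewrite !inE.
  by case: (_ == _); case: (_ == _) => /=; ring.
pose t e := if s e then tail D e else Defs.head D e.
pose h e := if s e then Defs.head D e else tail D e.
have th e : ends e = [set t e; h e].
  by rewrite /t /h (orientation_ends D); case: (s e) => //; rewrite setUC.
have flip v : netflow t h (fun=> 1) v = netflow (tail D) (Defs.head D) (fun e => sgn (s e)) v.
  by apply: eq_bigr => e _; rewrite /t /h /sgn; case: (s e); ring.
have [r rP] : exists r, forall v, excess t h r v = 0.
  by apply: integral_lift => v; rewrite flip.
exists (Orientation th), (lift_value r); split=> [e|v].
  by rewrite /lift_value; case: (r e).
have /eqP := rP v; rewrite /excess /netflow /out_arcs /in_arcs /=.
under eq_bigr => e _ do rewrite mulrBr.
rewrite sumrB subr_eq0 => /eqP eq_th.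
rewrite !(big_mkcond (fun e => e \in _)) /=.
transitivity (\sum_e lift_value r e * (t e == v)%:Z).
  by apply: eq_bigr => e _; rewrite inE; case: (_ == _) => /=; ring.
by rewrite eq_th; apply: eq_bigr => e _; rewrite inE; case: (_ == _) => /=; ring.
Qed.

(** If fewer than [k] edges leave [S], deleting them disconnects [S] from the rest.
Conversely, after the deletion of a set of edges, no remaining edge leaves the set of
vertices reachable from [x]. *)
Lemma edge_connectedP k (G : multigraph) (D : orientation G) : (0 < k)%N ->
  edge_connected k G <-> cut_connected k (tail D) (Defs.head D).
Proof.
move=> k_gt0; split=> [kG|[V_gt0 kG] T ltT].
  split=> [|S S0 ST]; first by have [] := kG set0; rewrite ?cards0.
  pose T := [set e | (tail D e \in S) != (Defs.head D e \in S)].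
  have -> : cut (tail D) (Defs.head D) S = #|T|.
    rewrite -sum1_card [RHS]big_mkcond; apply: eq_bigr => e _; rewrite inE.
    by case: (_ != _).
  rewrite leqNgt; apply/negP => /kG[_ conn].
  have /set0Pn[x xS] := S0.
  have /set0Pn[y] : ~: S != set0 by rewrite -setCT (inj_eq (@setC_inj _)).
  rewrite inE => yS.
  have cl : closed (@adjacent (delete_edges T)) (mem S).
    move=> u w /existsP[[e eT] /eqP /= uw].
    move: uw eT; rewrite (orientation_ends D) => /set2_eq uw.
    rewrite inE negbK => /eqP.
    by case: uw => -[-> ->] ->.
  by have := closed_connect cl (conn x y); rewrite xS (negbTE yS).
split=> // x y; apply: contraT => nxy.
pose S := [set z | connect (@adjacent (delete_edges T)) x z].
have S0 : S != set0 by apply/set0Pn; exists x; rewrite inE connect0.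
have ST : S != setT by apply: contraNneq nxy => /setP/(_ y); rewrite !inE.
have := kG S S0 ST; rewrite leqNgt => /negP[]; apply: leq_ltn_trans ltT.
rewrite -sum1_card [X in (_ <= X)%N]big_mkcond; apply: leq_sum => e _.
case: ifPn => [_|eT]; first by case: (_ != _).
rewrite leqn0 eqb0 negbK; apply/eqP.
have st u w : ends e = [set u; w] -> u \in S -> w \in S.
  move=> uw; rewrite !inE => /connect_trans; apply; apply: connect1.
  by apply/existsP; exists (exist _ e eT); apply/eqP.
by apply/idP/idP; apply: st; rewrite (orientation_ends D) // setUC.
Qed.

Lemma degree_cut (G : multigraph) (D : orientation G) v :
  degree v = cut (tail D) (Defs.head D) [set v].
Proof.
rewrite /degree -sum1_card big_mkcond; apply: eq_bigr => e _.
rewrite !inE (orientation_ends D) !inE !(eq_sym v).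
have := loopless e; rewrite (orientation_ends D) cards2.
have [tv|_] := eqVneq (tail D e) v; have [hv|_] := eqVneq (Defs.head D e) v => //.
by rewrite tv hv eqxx.
Qed.

(** A digraph with loops becomes a multigraph once its loops are dropped. *)
Section Realization.
Variables (V E : finType) (a b : E -> V).

Lemma realization_loopless (e : {e | a e != b e}) :
  #|[set a (val e); b (val e)]| = 2%N.
Proof. by rewrite cards2 (valP e). Qed.

Definition realization : multigraph := MultiGraph realization_loopless.

Definition realization_orientation : orientation realization :=
  @Orientation realization (fun e => a (val e)) (fun e => b (val e))
    (fun e => erefl).

Lemma realization_cut S :
  cut (tail realization_orientation) (Defs.head realization_orientation) S
  = cut a b S.
Proof.
rewrite /cut -(big_sub (fun e => a e != b e) (fun e => (a e \in S) != (b e \in S) : nat)).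
rewrite big_mkcond /=; apply: eq_bigr => e _.
have [abe|abe] := eqVneq (a e) (b e); last by rewrite ifT.
by rewrite abe eqxx; case: ifP.
Qed.

Lemma realization_connected k : (0 < k)%N ->
  cut_connected k a b -> edge_connected k realization.
Proof.
move=> k_gt0 [V_gt0 kab]; apply/(edge_connectedP realization_orientation k_gt0).
by split=> // S S0 ST; rewrite realization_cut; apply: kab.
Qed.

Lemma realization_degree v :
  degree (v : vertex realization) = cut a b [set v].
Proof.
rewrite -realization_cut; exact: degree_cut.
Qed.

Lemma realization_flow : has_nowhere_zero_3flow realization -> orientable3 a b.
Proof.
move/(nowhere_zero_3flowP realization_orientation) => [s sP].
exists (fun e => if insub e is Some e' then s e' else true) => v.
have := sP v; rewrite /netflow /=.
rewrite [X in _ -> (_ %| X)%Z](bigID (fun e => a e != b e)) /=.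
rewrite [X in _ -> (_ %| _ + X)%Z]big1 ?addr0; last first.
  by move=> e; rewrite negbK => /eqP ->; rewrite subrr mulr0.
rewrite (big_sub (fun e => a e != b e)
  (fun e => sgn (if insub e is Some e' then s e' else true) * ((a e == v)%:Z - (b e == v)%:Z))).
set A := \sum_i _; set B := \sum_i _.
suff -> : A = B by [].
by apply: eq_bigr => e _; rewrite valK.
Qed.

End Realization.

(** * Raising the minimum degree *)

Section Pendants.
Variables (V E : finType) (a b : E -> V).

(** Each vertex [inl v] is joined to a twin [inr v] by 6 parallel edges. *)
Definition pendant_tail (e : E + V * 'I_6) : V + V :=
  match e with inl e => inl (a e) | inr p => inl p.1 end.
Definition pendant_head (e : E + V * 'I_6) : V + V :=
  match e with inl e => inl (b e) | inr p => inr p.1 end.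

Lemma pendant_cut S :
  cut pendant_tail pendant_head S =
  (cut a b [set v | inl v \in S] +
   6 * \sum_v ((inl v \in S) != (inr v \in S)))%N.
Proof.
rewrite /cut big_sumType /=; congr addn.
  by apply: eq_bigr => e _; rewrite !inE.
rewrite -(pair_bigA _ (fun v k => ((inl v \in S) != (inr v \in S) : nat))) /=.
by rewrite big_distrr; apply: eq_bigr => v _; rewrite sum_nat_const card_ord.
Qed.

Lemma pendant_connected k : (k <= 6)%N -> cut_connected k a b ->
  cut_connected k pendant_tail pendant_head.
Proof.
move=> k6 [V_gt0 kab]; split=> [|S S0 ST].
  by rewrite card_sum addn_gt0 V_gt0.
rewrite pendant_cut.
have [/existsP[v vS]|] := boolP [exists v, (inl v \in S) != (inr v \in S)].
  by rewrite (bigD1 v) //= vS; lia.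
rewrite negb_exists => /forallP same.
have {}same v : (inr v \in S) = (inl v \in S) by have := same v; rewrite negbK => /eqP.
apply: leq_trans (leq_addr _ _); apply: kab.
  apply: contraNneq S0 => /setP eqS; apply/eqP/setP => -[] v;
  by have := eqS v; rewrite ?same !inE ?same.
apply: contraNneq ST => /setP eqS; apply/eqP/setP => -[] v;
by have := eqS v; rewrite ?same !inE ?same.
Qed.

Lemma pendant_degree v : (6 <= cut pendant_tail pendant_head [set v])%N.
Proof.
by case: v => v; rewrite pendant_cut (bigD1 v) //= !inE ?eqxx /=; lia.
Qed.

(** The net flow at a vertex of the original graph is the sum of those at the vertex and
at its twin, since the edges between the two cancel. *)
Lemma pendant_flow : orientable3 pendant_tail pendant_head -> orientable3 a b.
Proof.
move=> [s sP]; exists (fun e => s (inl e)) => v.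
suff -> : netflow a b (fun e => sgn (s (inl e))) v =
    netflow pendant_tail pendant_head (fun e => sgn (s e)) (inl v) +
    netflow pendant_tail pendant_head (fun e => sgn (s e)) (inr v).
  by have := sP (inl v); have := sP (inr v); lia.
rewrite /netflow -big_split big_sumType /= [X in _ = _ + X]big1 ?addr0.
  by apply: eq_bigr => e _; rewrite [X in _ = _ + X]mulr0 addr0.
move=> [w k] _ /=; have eq_inr : (inr w == inr v :> V + V) = (inl w == inl v :> V + V) by [].
by rewrite eq_inr; ring.
Qed.
End Pendants.

Lemma orientable3_of_5_6
  (flow56 : forall G : multigraph, edge_connected 5 G -> min_degree_ge 6 G ->
     has_nowhere_zero_3flow G)
  (V E : finType) (a b : E -> V) :
  cut_connected 5 a b -> orientable3 a b.
Proof.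
move=> con; apply/pendant_flow/realization_flow/flow56.
  by apply: realization_connected => //; apply: pendant_connected.
by move=> v; rewrite realization_degree pendant_degree.
Qed.

(** * Splitting off a vertex of degree 4 *)

Lemma big_four (R : nmodType) (E : finType) (h1 h2 h3 h4 : E) (F : E -> R) :
  uniq [:: h1; h2; h3; h4] ->
  \sum_e F e = F h1 + F h2 + F h3 + F h4
               + \sum_(e | e \notin [:: h1; h2; h3; h4]) F e.
Proof.
move=> hs; rewrite (bigID (mem [:: h1; h2; h3; h4])) /= -big_uniq //=.
by rewrite !big_cons big_nil addr0 !addrA.
Qed.

Definition prescribe (T : Type) (E : finType) (h1 h2 h3 h4 : E)
    (y1 y2 y3 y4 : T) (g : E -> T) (e : E) : T :=
  if e == h1 then y1 else if e == h2 then y2 else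
  if e == h3 then y3 else if e == h4 then y4 else g e.

Lemma prescribeE (T : Type) (E : finType) (h1 h2 h3 h4 : E) (y1 y2 y3 y4 : T) g
    (f := prescribe h1 h2 h3 h4 y1 y2 y3 y4 g) :
  uniq [:: h1; h2; h3; h4] -> [/\ f h1 = y1, f h2 = y2, f h3 = y3 & f h4 = y4].
Proof.
rewrite /f /prescribe !eqxx /= !inE !negb_or (eq_sym h2 h1) !(eq_sym h3) !(eq_sym h4).
rewrite (eq_sym h1 h3) (eq_sym h1 h4) (eq_sym h2 h3) (eq_sym h2 h4) (eq_sym h1 h2).
by case/and4P=> /and3P[/negbTE-> /negbTE-> /negbTE->] /andP[/negbTE-> /negbTE->]
  /negbTE-> _.
Qed.

Lemma prescribe_off (T : Type) (E : finType) (h1 h2 h3 h4 : E) (y1 y2 y3 y4 : T) g e :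
  e \notin [:: h1; h2; h3; h4] -> prescribe h1 h2 h3 h4 y1 y2 y3 y4 g e = g e.
Proof.
by rewrite /prescribe !inE !negb_or
  => /and4P[/negbTE-> /negbTE-> /negbTE-> /negbTE->].
Qed.

(** Swapping the ends of some edges lets every edge between [X] and its complement have
its [a]-end in [X]. *)
Lemma outward_reorientation (V E : finType) (a b : E -> V) (X : {set V}) :
  exists a' b', reorients a b a' b' /\ forall e, b' e \in X -> a' e \in X.
Proof.
pose w e := (b e \in X) && (a e \notin X).
exists (fun e => if w e then b e else a e), (fun e => if w e then a e else b e).
split=> e; first by case: (w e); auto.
by case: ifP; rewrite /w; case: (b e \in X); case: (a e \in X).
Qed.

(** Here [v] has exactly four edges [h1], ..., [h4] other than loops, all directed away
from [v].  Splitting off [v] replaces [h1] and [h2] by one edge between their heads, and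
[h3] and [h4] likewise. *)
Section SplitOff.
Variables (V E : finType) (a b : E -> V) (v : V) (h1 h2 h3 h4 : E).
Let hs := [:: h1; h2; h3; h4].
Hypothesis hs_uniq : uniq hs.
Hypothesis hsP : forall e, (e \in hs) = (a e == v) && (b e != v).
Hypothesis outward : forall e, b e == v -> a e == v.

Definition inner_cut (Y : {set V}) : nat :=
  (\sum_(e | e \notin hs) ((a e \in Y) != (b e \in Y)))%N.

Lemma hs_ends h : h \in hs -> a h = v /\ b h != v.
Proof. by rewrite hsP => /andP[/eqP]. Qed.

Lemma four_hs_ends :
  [/\ a h1 = v /\ b h1 != v, a h2 = v /\ b h2 != v,
      a h3 = v /\ b h3 != v & a h4 = v /\ b h4 != v].
Proof. by split; apply: hs_ends; rewrite !inE eqxx ?orbT. Qed.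

Lemma off_hs e : e \notin hs -> (a e == v) = (b e == v).
Proof.
rewrite hsP; have := @outward e.
by case: (a e == v); case: (b e == v) => //= /(_ isT).
Qed.

Lemma cut_avoiding (Y : {set V}) : v \notin Y ->
  cut a b Y = (inner_cut Y + ((b h1 \in Y) + (b h2 \in Y) + (b h3 \in Y) + (b h4 \in Y)))%N.
Proof.
move=> vY; rewrite /cut (big_four _ hs_uniq) addrC; congr addn.
have [[-> _] [-> _] [-> _] [-> _]] := four_hs_ends.
by rewrite (negbTE vY); do 4!case: (_ \in Y).
Qed.

Lemma inner_cut_compl Y : inner_cut (~: (v |: Y)) = inner_cut Y.
Proof.
apply: eq_bigr => e ehs; rewrite !in_setC !in_setU1.
have [av|av] := eqVneq (a e) v.
  have /eqP bv : b e == v by rewrite -off_hs // av.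
  by rewrite av bv !eqxx.
have /negbTE bv : b e != v by rewrite -off_hs.
by rewrite bv /=; case: (a e \in Y); case: (b e \in Y).
Qed.

(** A set like [Y] spoils the pairing of [h1] with [h2], a set like [Z] that of [h1] with
[h3].  Together they cut the other vertices into four cells, each containing the
head of one [h] and hence sending at least 3 edges to the other cells.  If [inner_cut Y]
is at most 3, then at least 2 edges join the two cells inside [Y], because
3 + 3 <= 3 + 2 * x12, and for the same reason at least 2 edges join the two
cells outside [Y].  All of these at least 4 edges cross [Z]. *)
Lemma not_both_bad (Y Z : {set V}) : cut_connected 4 a b ->
  v \notin Y -> v \notin Z ->
  [/\ b h1 \in Y, b h2 \in Y, b h3 \notin Y & b h4 \notin Y] ->
  [/\ b h1 \in Z, b h2 \notin Z, b h3 \in Z & b h4 \notin Z] ->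
  (inner_cut Y <= 3)%N -> (3 < inner_cut Z)%N.
Proof.
move=> [_ con] vY vZ [Y1 Y2 /negbTE Y3 /negbTE Y4] [Z1 /negbTE Z2 Z3 /negbTE Z4] cY.
have [[_ /negbTE n1] [_ /negbTE n2] [_ /negbTE n3] [_ /negbTE n4]] := four_hs_ends.
have cell (W : {set V}) n : v \notin W -> n \in W ->
    ((b h1 \in W) + (b h2 \in W) + (b h3 \in W) + (b h4 \in W) = 1)%N ->
    (3 <= inner_cut W)%N.
  move=> vW nW oneW; suff : (4 <= cut a b W)%N by rewrite cut_avoiding // oneW addn1 ltnS.
  by apply: con; [apply/set0Pn; exists n | apply: contraNneq vW => ->; rewrite inE].
have c1 : (3 <= inner_cut (Y :&: Z))%N.
  by apply: (cell _ (b h1)); rewrite !inE ?Y1 ?Y2 ?Y3 ?Y4 ?Z1 ?Z2 ?Z3 ?Z4 ?(negbTE vY) ?(negbTE vZ) ?eqxx.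
have c2 : (3 <= inner_cut (Y :\: Z))%N.
  by apply: (cell _ (b h2)); rewrite !inE ?Y1 ?Y2 ?Y3 ?Y4 ?Z1 ?Z2 ?Z3 ?Z4 ?(negbTE vY) ?(negbTE vZ) ?eqxx.
have c3 : (3 <= inner_cut (Z :\: Y))%N.
  by apply: (cell _ (b h3)); rewrite !inE ?Y1 ?Y2 ?Y3 ?Y4 ?Z1 ?Z2 ?Z3 ?Z4 ?(negbTE vY) ?(negbTE vZ) ?eqxx.
have c4 : (3 <= inner_cut (~: (v |: Y :|: Z)))%N.
  by apply: (cell _ (b h4)); rewrite !inE ?n1 ?n2 ?n3 ?n4 ?Y1 ?Y2 ?Y3 ?Y4 ?Z1 ?Z2 ?Z3 ?Z4 ?(negbTE vY) ?(negbTE vZ) ?eqxx.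
pose x12 := (\sum_(e | e \notin hs) [&& a e \in Y, b e \in Y & (a e \in Z) != (b e \in Z)])%N.
pose x34 := (\sum_(e | e \notin hs) [&& a e \notin Y, b e \notin Y & (a e \in Z) != (b e \in Z)])%N.
have e12 : (inner_cut (Y :&: Z) + inner_cut (Y :\: Z) = inner_cut Y + 2 * x12)%N.
  rewrite big_distrr -!big_split; apply: eq_bigr => e _; rewrite !inE /=.
  by move: (_ \in Y) (_ \in Z) (_ \in Y) (_ \in Z) => [] [] [] [].
have e34 : (inner_cut (Z :\: Y) + inner_cut (~: (v |: Y :|: Z)) = inner_cut Y + 2 * x34)%N.
  rewrite big_distrr -!big_split; apply: eq_bigr => e ehs; rewrite !inE /=.
  have [av|av] := eqVneq (a e) v.
    have /eqP bv : b e == v by rewrite -off_hs // av.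
    by rewrite av bv !eqxx ?(negbTE vY) ?(negbTE vZ).
  have /negbTE bv : b e != v by rewrite -off_hs.
  rewrite bv /=.
  by move: (_ \in Y) (_ \in Z) (_ \in Y) (_ \in Z) => [] [] [] [].
have : (x12 + x34 <= inner_cut Z)%N.
  rewrite -big_split; apply: leq_sum => e _ /=.
  by move: (_ \in Y) (_ \in Z) (_ \in Y) (_ \in Z) => [] [] [] [].
move: c1 c2 c3 c4 cY e12 e34; clearbody x12 x34; clear; lia.
Qed.

(** The edge type is kept: [h1] and [h3] become the two new edges, [h2] and [h4] become
loops. *)
Definition split_tail e := if e \in hs then b e else a e.
Definition split_head e := if e == h1 then b h2 else if e == h3 then b h4 else b e.

(** After the splitting no edge but loops touches [v], so its image is irrelevant. *)
Definition collapse (u : V) : {u | u != v} :=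
  insubd (exist _ (b h1) (proj2 (hs_ends (mem_head h1 [:: h2; h3; h4]))) : {u | u != v}) u.

Lemma val_collapse u : u != v -> val (collapse u) = u.
Proof. by move=> uv; rewrite /collapse insubdK. Qed.

Lemma collapse_val u : collapse (val u) = u.
Proof. by apply: val_inj; rewrite val_collapse //; apply: (valP u). Qed.

Lemma split_off e : e \notin hs -> split_tail e = a e /\ split_head e = b e.
Proof.
move=> ehs; rewrite /split_tail /split_head (negbTE ehs).
by move: ehs; rewrite !inE; case: (e == h1); case: (e == h2); case: (e == h3).
Qed.

Lemma split_hs :
  [/\ split_tail h1 = b h1 /\ split_head h1 = b h2,
      split_tail h2 = b h2 /\ split_head h2 = b h2,
      split_tail h3 = b h3 /\ split_head h3 = b h4 &
      split_tail h4 = b h4 /\ split_head h4 = b h4].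
Proof.
rewrite /split_tail /split_head !inE !eqxx /= !orbT.
move: hs_uniq; rewrite /= !inE !negb_or.
case/and4P=> /and3P[/negbTE n12 /negbTE n13 /negbTE n14] /andP[/negbTE n23 /negbTE n24] _ _.
by rewrite (eq_sym h2 h1) (eq_sym h3 h1) n12 n13 n23 (eq_sym h4 h1) n14; case: ifP.
Qed.

(** Splitting can only lower a cut below 4 if the set contains the two ends of one new
edge and neither end of the other. *)
Lemma split_connected :
  cut_connected 4 a b ->
  (forall Y : {set V}, v \notin Y -> (b h1 \in Y) = (b h2 \in Y) ->
     (b h3 \in Y) = (b h4 \in Y) -> (b h1 \in Y) != (b h3 \in Y) ->
     (4 <= inner_cut Y)%N) ->
  cut_connected 4 (collapse \o split_tail) (collapse \o split_head).
Proof.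
move=> [_ con] good; split=> [|S S0 ST].
  by apply/card_gt0P; exists (collapse v).
pose Y := [set u | (u != v) && (collapse u \in S)].
have inY u : u != v -> (u \in Y) = (collapse u \in S) by rewrite inE => ->.
have vY : v \notin Y by rewrite inE eqxx.
have -> : cut (collapse \o split_tail) (collapse \o split_head) S =
  (inner_cut Y + (((b h1 \in Y) != (b h2 \in Y)) + ((b h3 \in Y) != (b h4 \in Y))))%N.
  rewrite /cut (big_four _ hs_uniq) addrC; congr addn.
    apply: eq_bigr => e ehs; have [ta he] := split_off ehs.
    rewrite /= ta he.
    have [av|av] := eqVneq (a e) v.
      have /eqP bv : b e == v by rewrite -off_hs // av.
      by rewrite av bv !eqxx.
    by rewrite !inY // -off_hs.
  have [[t1 h1'] [t2 h2'] [t3 h3'] [t4 h4']] := split_hs.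
  rewrite /= t1 h1' t2 h2' t3 h3' t4 h4' !eqxx.
  have [[_ ?] [_ ?] [_ ?] [_ ?]] := four_hs_ends.
  by rewrite !inY //; do 4!case: (_ \in S).
have Y0 : Y != set0.
  have /set0Pn[u uS] := S0; apply/set0Pn; exists (val u).
  by rewrite inE (valP u) collapse_val.
have [u uY] : exists u : {u | u != v}, val u \notin Y.
  have /set0Pn[u] : ~: S != set0 by rewrite -setCT (inj_eq (@setC_inj _)).
  by rewrite inE => uS; exists u; rewrite inE (valP u) collapse_val.
have YT : Y != setT by apply: contraNneq vY => ->.
have cutY : (4 <= inner_cut Y +
    ((b h1 \in Y) + (b h2 \in Y) + (b h3 \in Y) + (b h4 \in Y)))%N.
  by rewrite -cut_avoiding //; apply: con.
have : (4 <= cut a b (v |: Y))%N.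
  apply: con; first by apply/set0Pn; exists v; rewrite !inE eqxx.
  apply: contraNneq uY => /setP/(_ (val u)); rewrite !inE.
  by rewrite (negbTE (valP u)) /= => ->.
rewrite -cut_setC cut_avoiding; last by rewrite !inE eqxx.
rewrite inner_cut_compl.
have [[_ /negbTE n1] [_ /negbTE n2] [_ /negbTE n3] [_ /negbTE n4]] := four_hs_ends.
rewrite !in_setC !in_setU1 n1 n2 n3 n4 /=.
move: cutY (good Y vY); move: (inner_cut Y) => c.
move: (b h1 \in Y) (b h2 \in Y) (b h3 \in Y) (b h4 \in Y); clear.
move=> [] [] [] [] /= cY good cVY;
  solve [clear good; lia | have := good erefl erefl isT; lia].
Qed.

(** The flow of the new edge replacing [h1] and [h2] is sent from the head of [h1] to [v]
along [h1], reversed, and on along [h2]; nothing accumulates at [v]. *)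
Lemma split_flow :
  orientable3 (collapse \o split_tail) (collapse \o split_head) ->
  orientable3 a b.
Proof.
move=> [s sP].
pose s' := prescribe h1 h2 h3 h4 (~~ s h1) (s h1) (~~ s h3) (s h3) s.
have [[t1 h1'] [t2 h2'] [t3 h3'] [t4 h4']] := split_hs.
have [[a1 n1] [a2 n2] [a3 n3] [a4 n4]] := four_hs_ends.
have [s1 s2 s3 s4] : [/\ s' h1 = ~~ s h1, s' h2 = s h1, s' h3 = ~~ s h3 & s' h4 = s h3].
  exact: prescribeE.
exists s' => u.
suff -> : netflow a b (fun e => sgn (s' e)) u = if u == v then 0 else
    netflow (collapse \o split_tail) (collapse \o split_head)
      (fun e => sgn (s e)) (collapse u).
  by case: ifP => // _; apply: sP.
rewrite /netflow !(big_four _ hs_uniq) s1 s2 s3 s4 a1 a2 a3 a4 /=.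
rewrite t1 h1' t2 h2' t3 h3' t4 h4'.
have coll x : u != v -> x != v -> (collapse x == collapse u) = (x == u).
  by move=> uv xv; rewrite -val_eqE /= !val_collapse.
have [->|uv] := eqVneq u v.
  rewrite big1 ?addr0.
    rewrite (negbTE n1) (negbTE n2) (negbTE n3) (negbTE n4).
    by case: (s h1); case: (s h3).
  by move=> e ehs; rewrite off_hs // subrr mulr0.
rewrite !coll //; congr (_ + _).
  by rewrite /sgn; case: (s h1); case: (s h3) => /=; ring.
apply: eq_bigr => e ehs; have [-> ->] := split_off ehs.
have -> : s' e = s e by apply: prescribe_off.
have [av|av] := eqVneq (a e) v.
  have /eqP bv : b e == v by rewrite -off_hs // av.
  by rewrite av bv !subrr.
by rewrite !coll // -off_hs.
Qed.

(** The complement of a spoiling set, without [v], spoils as well, so one may ask for the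
heads of [h1] and [h2] to be inside. *)
Lemma split_connected_or_bad :
  cut_connected 4 a b ->
  cut_connected 4 (collapse \o split_tail) (collapse \o split_head) \/
  exists Y : {set V}, [/\ v \notin Y, (inner_cut Y <= 3)%N &
    [/\ b h1 \in Y, b h2 \in Y, b h3 \notin Y & b h4 \notin Y]].
Proof.
move=> con.
pose sep (Y : {set V}) := [&& v \notin Y, (b h1 \in Y) == (b h2 \in Y),
  (b h3 \in Y) == (b h4 \in Y) & (b h1 \in Y) != (b h3 \in Y)].
have [/existsP[Y p]|none] := boolP [exists Y, sep Y && (inner_cut Y <= 3)%N]; last first.
  left; apply: split_connected => // Y vY /eqP Y12 /eqP Y34 Y13.
  rewrite ltnNge; apply: contraNN none => cY; apply/existsP; exists Y.
  by rewrite /sep vY Y12 Y34 Y13.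
right; case/andP: p => /and4P[vY /eqP Y12 /eqP Y34 Y13] cY.
have [Y1|Y1] := boolP (b h1 \in Y).
  by exists Y; split => //; rewrite -Y12 -Y34 Y1; move: Y13; rewrite Y1; case: (_ \in Y).
exists (~: (v |: Y)); rewrite inner_cut_compl; split=> //; first by rewrite !inE eqxx.
have [[_ /negbTE n1] [_ /negbTE n2] [_ /negbTE n3] [_ /negbTE n4]] := four_hs_ends.
rewrite !inE n1 n2 n3 n4 -Y12 -Y34 Y1 /=.
by move: Y13; rewrite (negbTE Y1); case: (_ \in Y).
Qed.

End SplitOff.

Lemma card4P (T : finType) (A : {set T}) : #|A| = 4%N ->
  exists h1 h2 h3 h4, uniq [:: h1; h2; h3; h4] /\
    forall e, (e \in [:: h1; h2; h3; h4]) = (e \in A).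
Proof.
rewrite cardE; case eA: (enum A) => [|h1 [|h2 [|h3 [|h4 [|]]]]] // _.
exists h1, h2, h3, h4; split; first by rewrite -eA enum_uniq.
by move=> e; rewrite -eA mem_enum.
Qed.

(** By [not_both_bad], pairing [h1] with [h2] or pairing [h1] with [h3] works. *)
Lemma degree4_reduction (V E : finType) (a b : E -> V) (v : V) :
  (forall (V' E' : finType) (a' b' : E' -> V'), (#|V'| < #|V|)%N ->
     cut_connected 4 a' b' -> orientable3 a' b') ->
  cut_connected 4 a b -> cut a b [set v] = 4%N -> orientable3 a b.
Proof.
move=> IH con dv; have [a' [b' [ab' out']]] := outward_reorientation a b [set v].
have ab : reorients a' b' a b by move=> e; case: (ab' e) => -[-> ->]; auto.
apply: orientable3_reorients ab _.
have {}con : cut_connected 4 a' b'.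
  by case: con => ? con; split=> // S S0 ST; rewrite (cut_reorients _ ab'); apply: con.
have {dv} : cut a' b' [set v] = 4%N by rewrite (cut_reorients _ ab').
move: a' b' {ab'} out' con => {}a {}b out con dv.
have {}out e : b e == v -> a e == v by have := out e; rewrite !inE.
have /card4P[h1 [h2 [h3 [h4 [hs_uniq hsP]]]]] : #|[set e | (a e == v) && (b e != v)]| = 4%N.
  rewrite -{}dv -sum1_card big_mkcond; apply: eq_bigr => e _; rewrite !inE.
  by have := out e; case: (a e == v); case: (b e == v) => //= /(_ isT).
have {}hsP e : (e \in [:: h1; h2; h3; h4]) = (a e == v) && (b e != v).
  by rewrite hsP inE.
have ltV : (#|{: {u | u != v}}| < #|V|)%N.
  by rewrite card_sig cardC1 prednK //; apply/card_gt0P; exists v.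
have [con'|[Y [vY cY Ysep]]] := split_connected_or_bad hs_uniq hsP out con.
  by apply: (split_flow hs_uniq out); apply: IH ltV con'.
have perm e : (e \in [:: h1; h3; h2; h4]) = (e \in [:: h1; h2; h3; h4]).
  by rewrite !inE; congr orb; rewrite orbCA.
have hs'_uniq : uniq [:: h1; h3; h2; h4].
  rewrite (perm_uniq (_ : perm_eq _ [:: h1; h2; h3; h4])) //=.
  by rewrite perm_cons (perm_catCA [:: h3] [:: h2] [:: h4]).
have hs'P e : (e \in [:: h1; h3; h2; h4]) = (a e == v) && (b e != v).
  by rewrite perm hsP.
have [con'|[Z [vZ cZ [Z1 Z3 Z2 Z4]]]] := split_connected_or_bad hs'_uniq hs'P out con.
  by apply: (split_flow hs'_uniq out); apply: IH ltV con'.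
have := not_both_bad hs_uniq hsP out con vY vZ Ysep (And4 Z1 Z2 Z3 Z4) cY.
rewrite ltnNge -[X in ~~ (X <= _)%N](_ : inner_cut a b h1 h3 h2 h4 Z = _) ?cZ //.
by apply: eq_bigl => e; rewrite perm.
Qed.

(** * Five copies of a set with a forbidden pattern *)

(** Let k be the number of [i] satisfying [m].  Two distinct indices modulo 5 differ by 1 or
by 2, so the two sums on the left count at most k (k - 1) together, and
5 + k (k - 1) <= 5 k for k = 1, ..., 5.  This is checked case by case. *)
Lemma pentagon_count (m : 'I_5 -> bool) : (exists i, m i) ->
  (5 + \sum_i 2 * (m i && m (ordS i)) + \sum_i 2 * (m i && m (ordS (ordS i)))
    <= \sum_i 5 * m i)%N.
Proof.
move=> [i0 mi0].
pose g k := nth false [seq m i | i <- enum 'I_5] k.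
have mE i : m i = g i.
  by rewrite /g (nth_map ord0) ?size_enum_ord // nth_ord_enum.
have : g i0 by rewrite -mE.
under eq_bigr do rewrite !mE; under [X in (_ + X <= _)%N]eq_bigr do rewrite !mE.
under [X in (_ <= X)%N]eq_bigr do rewrite !mE.
rewrite !big_ord_recl !big_ord0 /=.
case: i0 {mi0} => [] [|[|[|[|[|]]]]] //= _;
  move: (g 0%N) (g 1%N) (g 2%N) (g 3%N) (g 4%N) => [] [] [] [] [] //.
Qed.

Lemma sum_at (F : 'I_5 -> int) (s t : 'I_5 -> 'I_5) (j : 'I_5) (c : bool) :
  cancel s t -> cancel t s -> \sum_i F i * ((s i == j) && c)%:Z = F (t j) * c%:Z.
Proof.
move=> sK tK; rewrite (bigD1 (t j)) //= tK eqxx big1 ?addr0 // => i it.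
by rewrite (can2_eq sK tK) (negbTE it) mulr0.
Qed.

(** [h1], ..., [h4] are the edges between [X] and its complement, all directed out of
[X]. *)
Section Pentagon.
Variables (V E : finType) (a b : E -> V) (X : {set V}) (h1 h2 h3 h4 : E).
Let hs := [:: h1; h2; h3; h4].
Hypothesis hs_uniq : uniq hs.
Hypothesis hsP : forall e, (e \in hs) = (a e \in X) && (b e \notin X).
Hypothesis outward : forall e, b e \in X -> a e \in X.

Lemma hs_crossing :
  [/\ a h1 \in X /\ b h1 \notin X, a h2 \in X /\ b h2 \notin X,
      a h3 \in X /\ b h3 \notin X & a h4 \in X /\ b h4 \notin X].
Proof. by split; apply/andP; rewrite -hsP !inE eqxx ?orbT. Qed.

Lemma off_crossing e : e \notin hs -> (a e \in X) = (b e \in X).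
Proof.
rewrite hsP; have := @outward e.
by case: (a e \in X); case: (b e \in X) => //= /(_ isT).
Qed.

Lemma netflow_inside f x : x \in X ->
  netflow a b f x =
    f h1 * (a h1 == x)%:Z + f h2 * (a h2 == x)%:Z + f h3 * (a h3 == x)%:Z
    + f h4 * (a h4 == x)%:Z
    + \sum_(e | e \notin hs) f e * ((a e == x)%:Z - (b e == x)%:Z).
Proof.
move=> xX; rewrite /netflow (big_four _ hs_uniq); congr (_ + _).
have out h : b h \notin X -> (b h == x) = false.
  by move=> bh; apply: contraNF bh => /eqP ->.
have [[_ /out->] [_ /out->] [_ /out->] [_ /out->]] := hs_crossing.
by rewrite !subr0.
Qed.

Lemma cut_inside (Y : {set V}) : Y \subset X ->
  cut a b Y = (\sum_(e | e \notin hs) ((a e \in Y) != (b e \in Y))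
    + ((a h1 \in Y) + (a h2 \in Y) + (a h3 \in Y) + (a h4 \in Y)))%N.
Proof.
move=> YX; rewrite /cut (big_four _ hs_uniq) addrC; congr addn.
have out h : b h \notin X -> (b h \in Y) = false.
  by move=> bh; apply: contraNF bh; apply: (subsetP YX).
have [[_ /out->] [_ /out->] [_ /out->] [_ /out->]] := hs_crossing.
by do 4!case: (_ \in Y).
Qed.

(** Five copies of [X] and one more vertex [None]; vertices outside [X] go to [None]. *)
Definition place (i : 'I_5) (x : V) : option ('I_5 * {x | x \in X}) :=
  omap (pair i) (insub x).

(** The edges are, in this order: five copies of the edges inside [X], all other edges being
turned into loops at [None]; the edges from each copy of the end of [h1] to
the next copy of the end of [h2]; the edges from each copy of the end of [h4] to the second
next copy of the same end, which thus has two of them; the edges from each copy of the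
end of [h3] to [None]. *)
Definition pentagon_tail (t : 'I_5 * E + 'I_5 + 'I_5 + 'I_5) :=
  match t with
  | inl (inl (inl p)) => if p.2 \in hs then None else place p.1 (a p.2)
  | inl (inl (inr i)) => place i (a h1)
  | inl (inr i) => place i (a h4)
  | inr i => place i (a h3)
  end.

Definition pentagon_head (t : 'I_5 * E + 'I_5 + 'I_5 + 'I_5) :=
  match t with
  | inl (inl (inl p)) => if p.2 \in hs then None else place p.1 (b p.2)
  | inl (inl (inr i)) => place (ordS i) (a h2)
  | inl (inr i) => place (ordS (ordS i)) (a h4)
  | inr i => None
  end.

Lemma place_eq i j x y : x \in X -> (place i y == place j x) = (i == j) && (y == x).
Proof.
move=> xX; rewrite /place; have [yX|yX] := boolP (y \in X).
  by rewrite !insubT.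
rewrite insubN // insubT andbC; have [yx|_] := eqVneq y x => //.
by rewrite yx xX in yX.
Qed.

Lemma place_val i (u : {x | x \in X}) : place i (val u) = Some (i, u).
Proof. by rewrite /place valK. Qed.

Lemma place_out i x : x \notin X -> place i x = None.
Proof. by move=> xX; rewrite /place insubN. Qed.

Lemma pentagon_cut (S : {set option ('I_5 * {x | x \in X})}) : None \notin S ->
  cut pentagon_tail pentagon_head S =
  (\sum_i \sum_(e | e \notin hs) ((place i (a e) \in S) != (place i (b e) \in S))
  + \sum_i ((place i (a h1) \in S) != (place (ordS i) (a h2) \in S))
  + \sum_i ((place i (a h4) \in S) != (place (ordS (ordS i)) (a h4) \in S))
  + \sum_i (place i (a h3) \in S))%N.
Proof.
move=> NS; rewrite /cut !big_sumType /=; congr (_ + _ + _ + _)%N.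
  rewrite -(pair_bigA _ (fun i e =>
    ((if e \in hs then None else place i (a e)) \in S) !=
    ((if e \in hs then None else place i (b e)) \in S) : nat)) /=.
  apply: eq_bigr => i _; rewrite [RHS]big_mkcond /=; apply: eq_bigr => e _.
  by case: (e \in hs); rewrite //= eqxx.
by apply: eq_bigr => i _; rewrite (negbTE NS); case: (_ \in S).
Qed.

(** Let a set avoiding [None] meet k copies of [X].  Each of the k traces is left by at least
5 edges when those going to other copies or to [None] are included: by hypothesis if it is a
proper subset of [X], and as [X] has five such edges otherwise.  An edge joining two of
the k copies is counted at most twice here without crossing the set, and there are at most
k (k - 1) / 2 of those, so the cut has at least 5 k - k (k - 1) >= 5 edges.  A set
containing [None] is replaced by its complement. *)
Lemma pentagon_connected :
  (forall Y : {set V}, Y != set0 -> Y \proper X -> (5 <= cut a b Y)%N) ->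
  cut_connected 5 pentagon_tail pentagon_head.
Proof.
move=> X_min; split; first by apply/card_gt0P; exists None.
move=> S S0 ST; wlog NS : S S0 ST / None \notin S.
  move=> th; have [NS|/th] := boolP (None \in S); last exact.
  rewrite -cut_setC; apply: th; last by rewrite inE negbK.
    by rewrite -setCT (inj_eq (@setC_inj _)).
  by rewrite -setC0 (inj_eq (@setC_inj _)).
pose Y i := [set x | place i x \in S].
have inY i x : (place i x \in S) = (x \in Y i) by rewrite inE.
have YX i : Y i \subset X.
  by apply/subsetP => x; rewrite inE; apply: contraTT => xX; rewrite place_out.
pose m i := Y i != set0.
pose n i := (\sum_(e | e \notin hs) ((a e \in Y i) != (b e \in Y i)))%N.
have mY i x : (x \in Y i) -> m i by move=> xY; apply/set0Pn; exists x.
have -> : cut pentagon_tail pentagon_head S =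
    (\sum_i n i + \sum_i ((a h1 \in Y i) != (a h2 \in Y (ordS i)))
     + \sum_i ((a h4 \in Y i) != (a h4 \in Y (ordS (ordS i))))
     + \sum_i (a h3 \in Y i))%N.
  rewrite pentagon_cut //; congr (_ + _ + _ + _)%N; apply: eq_bigr => i _; rewrite ?inY //.
  by apply: eq_bigr => e _; rewrite !inY.
have loc i : (5 * m i <= n i + ((a h1 \in Y i) + (a h2 \in Y i) +
    (a h3 \in Y i) + (a h4 \in Y i) + (a h4 \in Y i)))%N.
  have [Yi0|] := eqVneq (Y i) set0; first by rewrite /m Yi0 eqxx.
  move=> Yi0; rewrite /m Yi0 muln1.
  have [YiX|YiX] := eqVneq (Y i) X.
    have [[t1 _] [t2 _] [t3 _] [t4 _]] := hs_crossing.
    by rewrite YiX t1 t2 t3 t4 (leq_trans _ (leq_addl _ _)).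
  have : (5 <= cut a b (Y i))%N by apply: X_min; rewrite // properEneq YiX YX.
  by rewrite cut_inside // => /leq_trans; apply; rewrite leq_add2l leq_addr.
have edge_le i j x y : ((x \in Y i) + (y \in Y j) <=
    ((x \in Y i) != (y \in Y j)) + 2 * (m i && m j))%N.
  have := @mY i x; have := @mY j y.
  by move: (x \in Y i) (y \in Y j) (m i) (m j) => [] [] [] [] //= h; move=> // h'; have := h isT; have := h' isT.
have [i0 mi0] : exists i, m i.
  have /set0Pn[[[i u]|] uS] := S0; last by rewrite uS in NS.
  by exists i; apply: (mY i (val u)); rewrite inE place_val.
have pent := pentagon_count (ex_intro _ i0 mi0).
have sum_loc : (\sum_i 5 * m i <= \sum_i (n i + ((a h1 \in Y i) + (a h2 \in Y i) +
    (a h3 \in Y i) + (a h4 \in Y i) + (a h4 \in Y i))))%N.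
  by apply: leq_sum => i _; apply: loc.
have sum_edges (s : 'I_5 -> 'I_5) x y :
  (\sum_i ((x \in Y i) + (y \in Y (s i))) <=
   \sum_i (((x \in Y i) != (y \in Y (s i))) + 2 * (m i && m (s i))))%N.
  by apply: leq_sum => i _; apply: edge_le.
have shift (F : 'I_5 -> nat) : (\sum_i F (ordS i) = \sum_i F i)%N.
  by rewrite [RHS](reindex_inj (@ordS_inj 5)).
have := sum_edges (fun i => ordS (ordS i)) (a h4) (a h4).
have := sum_edges (@ordS 5) (a h1) (a h2).
move: pent sum_loc; rewrite !big_split /=.
rewrite (shift (fun i => (a h2 \in Y i) : nat)).
rewrite (shift (fun i => (a h4 \in Y (ordS i)) : nat)) (shift (fun i => (a h4 \in Y i) : nat)).
move: (\sum_(i < 5) n i)%N (\sum_(i < 5) (a h3 \in Y i))%N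
  (\sum_(i < 5) ((a h1 \in Y i) != (a h2 \in Y (ordS i))))%N
  (\sum_(i < 5) ((a h4 \in Y i) != (a h4 \in Y (ordS (ordS i)))))%N
  (\sum_(i < 5) (a h1 \in Y i))%N (\sum_(i < 5) (a h2 \in Y i))%N
  (\sum_(i < 5) (a h4 \in Y i))%N (\sum_(i < 5) m i)%N
  (\sum_(i < 5) (m i && m (ordS i)))%N
  (\sum_(i < 5) (m i && m (ordS (ordS i))))%N (\sum_(i < 5) 0)%N.
clear; lia.
Qed.

Lemma pentagon_netflow f j x : x \in X ->
  netflow pentagon_tail pentagon_head f (place j x) =
    f (inl (inl (inr j))) * (a h1 == x)%:Z
    - f (inl (inl (inr (ord_pred j)))) * (a h2 == x)%:Z
    + f (inr j) * (a h3 == x)%:Z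
    + (f (inl (inr j)) - f (inl (inr (ord_pred (ord_pred j))))) * (a h4 == x)%:Z
    + \sum_(e | e \notin hs) f (inl (inl (inl (j, e)))) * ((a e == x)%:Z - (b e == x)%:Z).
Proof.
move=> xX; rewrite /netflow !big_sumType /=.
have idK : cancel (@id 'I_5) id by [].
have ss_pp : cancel (fun i : 'I_5 => ordS (ordS i)) (fun i => ord_pred (ord_pred i)).
  by move=> i; rewrite !ordSK.
have pp_ss : cancel (fun i : 'I_5 => ord_pred (ord_pred i)) (fun i => ordS (ordS i)).
  by move=> i; rewrite !ord_predK.
have inner : \sum_p f (inl (inl (inl p))) *
      (((if p.2 \in hs then None else place p.1 (a p.2)) == place j x)%:Z
       - ((if p.2 \in hs then None else place p.1 (b p.2)) == place j x)%:Z)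
    = \sum_(e | e \notin hs) f (inl (inl (inl (j, e)))) * ((a e == x)%:Z - (b e == x)%:Z).
  transitivity (\sum_i \sum_e f (inl (inl (inl (i, e)))) *
      (((if e \in hs then None else place i (a e)) == place j x)%:Z
       - ((if e \in hs then None else place i (b e)) == place j x)%:Z)).
    by rewrite pair_bigA; apply: eq_bigr => -[i e].
  rewrite (bigD1 j) //= [X in _ + X]big1 ?addr0 => [|i ij].
    rewrite [RHS]big_mkcond; apply: eq_bigr => e _.
    by case: (e \in hs); rewrite /= ?subrr ?mulr0 // !place_eq // eqxx.
  apply: big1 => e _; case: (e \in hs); rewrite /= ?subrr ?mulr0 //.
  by rewrite !place_eq // (negbTE ij) subrr mulr0.
rewrite inner; set I := \sum_(e | _) _.
have -> : \sum_i f (inl (inl (inr i))) * ((place i (a h1) == place j x)%:Z -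
      (place (ordS i) (a h2) == place j x)%:Z) =
    f (inl (inl (inr j))) * (a h1 == x)%:Z - f (inl (inl (inr (ord_pred j)))) * (a h2 == x)%:Z.
  rewrite -(sum_at (fun i => f (inl (inl (inr i)))) j _ idK idK).
  rewrite -(sum_at (fun i => f (inl (inl (inr i)))) j _ (@ordSK 5) (@ord_predK 5)).
  by rewrite -sumrB; apply: eq_bigr => i _; rewrite !place_eq // mulrBr.
have -> : \sum_i f (inl (inr i)) * ((place i (a h4) == place j x)%:Z -
      (place (ordS (ordS i)) (a h4) == place j x)%:Z) =
    (f (inl (inr j)) - f (inl (inr (ord_pred (ord_pred j))))) * (a h4 == x)%:Z.
  rewrite mulrBl -(sum_at (fun i => f (inl (inr i))) j _ idK idK).
  rewrite -(sum_at (fun i => f (inl (inr i))) j _ ss_pp pp_ss).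
  by rewrite -sumrB; apply: eq_bigr => i _; rewrite !place_eq // mulrBr.
have -> : \sum_i f (inr i) * ((place i (a h3) == place j x)%:Z - (None == place j x)%:Z) =
    f (inr j) * (a h3 == x)%:Z.
  rewrite -(sum_at (fun i => f (inr i)) j _ idK idK).
  apply: eq_bigr => i _; rewrite place_eq //.
  by rewrite /place insubT /= subr0.
ring.
Qed.

(** Let x1, ..., x5 be the signs, directed outwards, of the five edges at copy [j]; x4 and
x5 belong to the two edges at the end of [h4].  Their sum is a multiple of 3, so they split
4 to 1.  If x3 were the minority, then x4 = x5, and two units out of the end of [h4] are
congruent to one unit in, so giving [h4] the sign ~~ x4 would produce the excluded pattern.
Hence x1, x2, x4, x5 contain three signs equal to x3 and one other sign.  Summed over
the copies, each edge between copies has exactly one outward positive sign, so that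
10 = 2 * (sum of x3) + 5, which is absurd. *)
Lemma pentagon_not_orientable :
  (forall s : E -> bool,
     (forall x, x \in X -> (3 %| netflow a b (fun e => sgn (s e)) x)%Z) ->
     s h1 = s h2 -> s h3 = s h4 -> s h1 = s h3) ->
  ~ orientable3 pentagon_tail pentagon_head.
Proof.
move=> forb [s sP].
pose x1 j := s (inl (inl (inr j))).
pose x2 j := ~~ s (inl (inl (inr (ord_pred j)))).
pose x3 j := s (inr j).
pose x4 j := s (inl (inr j)).
pose x5 j := ~~ s (inl (inr (ord_pred (ord_pred j)))).
have local j : (x1 j + x2 j + x4 j + x5 j = 2 * x3 j + 1)%N.
  pose g e := sgn (s (inl (inl (inl (j, e))))).
  pose f y4 := prescribe h1 h2 h3 h4 (sgn (x1 j)) (sgn (x2 j)) (sgn (x3 j)) y4 g.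
  have fhs y4 : [/\ f y4 h1 = sgn (x1 j), f y4 h2 = sgn (x2 j), f y4 h3 = sgn (x3 j)
      & f y4 h4 = y4] by apply: prescribeE.
  have f_off y4 e : e \notin hs -> f y4 e = g e by apply: prescribe_off.
  have sgnK c : (sgn c == 1) = c by case: c.
  have sgnN c : sgn (~~ c) = - sgn c by case: c.
  (* With [y4 = sgn (x4 j) + sgn (x5 j)], the weights [f y4] on the original graph reproduce
     the net flow of copy [j]. *)
  have fE y4 x : x \in X -> netflow a b (f y4) x =
      netflow pentagon_tail pentagon_head (fun t => sgn (s t)) (place j x)
      + (y4 - (sgn (x4 j) + sgn (x5 j))) * (a h4 == x)%:Z.
    move=> xX; rewrite netflow_inside // pentagon_netflow //.
    have [-> -> -> ->] := fhs y4.
    rewrite (eq_bigr (fun e => sgn (s (inl (inl (inl (j, e))))) * ((a e == x)%:Z - (b e == x)%:Z))).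
      by rewrite /x1 /x2 /x3 /x4 /x5 !sgnN; ring.
    by move=> e ehs; rewrite f_off.
  have total : (3 %| sgn (x1 j) + sgn (x2 j) + sgn (x3 j) + (sgn (x4 j) + sgn (x5 j)))%Z.
    have : (3 %| \sum_(x in X) netflow a b (f (sgn (x4 j) + sgn (x5 j))) x)%Z.
      apply: (big_ind (fun y => (3 %| y)%Z)) => // [|x xX]; first exact: rpredD.
      by rewrite fE // subrr mul0r addr0.
    rewrite sum_netflow (big_four _ hs_uniq) big1 ?addr0 => [|e ehs]; last first.
      by rewrite off_crossing // subrr mulr0.
    have [-> -> -> ->] := fhs (sgn (x4 j) + sgn (x5 j)).
    have [[-> /negbTE->] [-> /negbTE->] [-> /negbTE->] [-> /negbTE->]] := hs_crossing.
    by rewrite !subr0 !mulr1.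
  (* The value [sgn (~~ x4 j)] differs from [sgn (x4 j) + sgn (x5 j)] by a multiple of 3. *)
  have avoid : x4 j = x5 j -> x1 j = x2 j -> x3 j = ~~ x4 j -> x1 j = x3 j.
    move=> x45 x12 x34.
    pose s' e := f (sgn (~~ x4 j)) e == 1.
    have s'E e : sgn (s' e) = f (sgn (~~ x4 j)) e.
      rewrite /s' /f /prescribe; do 4!(case: ifP => _; first by rewrite sgnK).
      by rewrite sgnK.
    have hsE c e : f (sgn (~~ x4 j)) e = sgn c -> s' e = c by rewrite /s' => ->.
    have [/hsE e1 /hsE e2 /hsE e3 /hsE e4] := fhs (sgn (~~ x4 j)).
    rewrite -e1 -e3; apply: forb; rewrite ?e1 ?e2 ?e3 ?e4 //.
    move=> x xX; rewrite (_ : netflow _ _ _ _ = netflow a b (f (sgn (~~ x4 j))) x); last first.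
      by apply: eq_bigr => e _; rewrite s'E.
    rewrite fE // sgnN -x45; move: (sP (place j x)) (x4 j) (a h4 == x).
    by move: (netflow _ _ _ _); clear => N N3 [] [] /=; rewrite /sgn; lia.
  move: total avoid; move: (x1 j) (x2 j) (x3 j) (x4 j) (x5 j).
  by move=> [] [] [] [] [] //= _ av; have := av erefl erefl erefl.
have shift (F : 'I_5 -> nat) : (\sum_i F (ord_pred i) = \sum_i F i)%N.
  by rewrite [RHS](reindex_inj (can_inj (@ord_predK 5))).
have compl (F : 'I_5 -> bool) : (\sum_i F i + \sum_i ~~ F i = 5)%N.
  rewrite -big_split /= -[RHS](card_ord 5) -sum1_card; apply: eq_bigr => i _.
  by case: (F i).
have sum12 : (\sum_j x1 j + \sum_j x2 j = 5)%N.
  by rewrite (shift (fun i => ~~ x1 i : nat)) compl.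
have sum45 : (\sum_j x4 j + \sum_j x5 j = 5)%N.
  rewrite (shift (fun i => ~~ x4 (ord_pred i) : nat)).
  by rewrite (shift (fun i => ~~ x4 i : nat)) compl.
have : (\sum_j x1 j + \sum_j x2 j + (\sum_j x4 j + \sum_j x5 j) = 2 * \sum_j x3 j + 5)%N.
  rewrite big_distrr -!big_split -[X in (_ + X)%N](card_ord 5) -sum1_card -big_split /=.
  by apply: eq_bigr => j _; rewrite addnA local.
by rewrite sum12 sum45; move: (\sum_j x3 j)%N; clear; lia.
Qed.

End Pentagon.

(** * A smallest set with a 4-edge cut *)

Section Contraction.
Variables (V E : finType) (a b : E -> V) (X : {set V}).
Hypothesis outward : forall e, b e \in X -> a e \in X.

(** All of [X] becomes the vertex [None]. *)
Definition contract (x : V) : option {x | x \notin X} := insub x.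

Lemma card_contract : (#|{: option {x | x \notin X}}| = #|~: X|.+1)%N.
Proof. by rewrite card_option card_sig; congr S; apply: eq_card => x; rewrite !inE. Qed.

Lemma contract_some u : contract (val u) = Some u.
Proof. by rewrite /contract valK. Qed.

Lemma contract_none x : (contract x == None) = (x \in X).
Proof. by rewrite /contract; case: insubP => [u /negbTE-> _|] //; rewrite negbK => ->. Qed.

Lemma contract_eq x v : v \notin X -> (contract x == contract v) = (x == v).
Proof.
move=> vX; rewrite /contract (insubT (fun x => x \notin X) vX).
have [xX|xX] := boolP (x \in X).
  rewrite insubN ?xX //; symmetry.
  by apply: contraNF vX => /eqP <-.
by rewrite (insubT (fun x => x \notin X) xX).
Qed.

Lemma contract_connected k : X != set0 -> cut_connected k a b ->
  cut_connected k (contract \o a) (contract \o b).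
Proof.
move=> /set0Pn[x0 x0X] [V_gt0 con].
have onto w : exists x, contract x = w.
  case: w => [u|]; first by exists (val u); apply: contract_some.
  by exists x0; apply/eqP; rewrite contract_none.
split=> [|S S0 ST]; first by apply/card_gt0P; exists None.
have -> : cut (contract \o a) (contract \o b) S = cut a b (contract @^-1: S).
  by apply: eq_bigr => e _; rewrite !inE.
apply: con.
  have /set0Pn[w wS] := S0; have [x xw] := onto w.
  by apply/set0Pn; exists x; rewrite inE xw.
apply: contraNneq ST => /setP preT; apply/eqP/setP => w; have [x <-] := onto w.
by have := preT x; rewrite !inE.
Qed.

Lemma contract_netflow f v : v \notin X ->
  netflow (contract \o a) (contract \o b) f (contract v) = netflow a b f v.
Proof. by move=> vX; apply: eq_bigr => e _; rewrite /= !contract_eq. Qed.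

Lemma contract_netflow_none f :
  netflow (contract \o a) (contract \o b) f None =
  \sum_(e | (a e \in X) && (b e \notin X)) f e.
Proof.
rewrite [RHS]big_mkcond; apply: eq_bigr => e _; rewrite /= !contract_none.
have := @outward e; case: (a e \in X); case: (b e \in X) => //= h.
- by rewrite subrr mulr0.
- by rewrite subr0 mulr1.
- by have := h isT.
- by rewrite subrr mulr0.
Qed.

(** Use [s] on the edges meeting [X] and [t] on the others; at a vertex outside [X] the two
agree on the edges coming from [X]. *)
Lemma glue_orientations (s t : E -> bool) :
  (forall x, x \in X -> (3 %| netflow a b (fun e => sgn (s e)) x)%Z) ->
  (forall w, (3 %| netflow (contract \o a) (contract \o b) (fun e => sgn (t e)) w)%Z) ->
  (forall e, a e \in X -> b e \notin X -> s e = t e) ->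
  orientable3 a b.
Proof.
move=> sP tP st; exists (fun e => if a e \in X then s e else t e) => v.
have [vX|vX] := boolP (v \in X).
  suff -> : netflow a b (fun e => sgn (if a e \in X then s e else t e)) v =
    netflow a b (fun e => sgn (s e)) v by apply: sP.
  apply: eq_bigr => e _; case: ifPn => // aX.
  have -> : (a e == v) = false by apply: contraNF aX => /eqP ->.
  have -> : (b e == v) = false.
    by apply: contraNF aX => /eqP bv; apply: outward; rewrite bv.
  by rewrite subrr !mulr0.
suff -> : netflow a b (fun e => sgn (if a e \in X then s e else t e)) v =
    netflow a b (fun e => sgn (t e)) v by rewrite -contract_netflow.
apply: eq_bigr => e _; case: ifPn => // aX.
have [bX|bX] := boolP (b e \in X); last by rewrite st.
have -> : (a e == v) = false by apply: contraNF vX => /eqP <-.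
have -> : (b e == v) = false by apply: contraNF vX => /eqP <-.
by rewrite subrr !mulr0.
Qed.

End Contraction.

(** Four signs have a sum divisible by 3 only if two of them are positive. *)
Lemma two_and_two (E : finType) (C : {set E}) (t : E -> bool) : #|C| = 4%N ->
  (3 %| \sum_(e in C) sgn (t e))%Z ->
  exists h1 h2 h3 h4, [/\ uniq [:: h1; h2; h3; h4],
    forall e, (e \in [:: h1; h2; h3; h4]) = (e \in C),
    t h1 && t h2 & ~~ t h3 && ~~ t h4].
Proof.
move=> C4 sumC.
pose A := [set e in C | t e]; pose B := [set e in C | ~~ t e].
have cardAB : (#|A| + #|B| = 4)%N.
  rewrite -C4 -(cardsID [set e | t e] C); congr (_ + _)%N; apply: eq_card => e.
    by rewrite !inE.
  by rewrite !inE andbC.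
have sumAB : \sum_(e in C) sgn (t e) = #|A|%:Z - #|B|%:Z.
  rewrite (bigID t) /=; congr (_ + _).
    rewrite -[RHS]natz -sumr_const; apply: eq_big => [e|e /andP[_ ->]] //.
    by rewrite inE.
  rewrite -[#|B|%:Z]natz -mulNrn -sumr_const; apply: eq_big => [e|e /andP[_ /negbTE->]] //.
  by rewrite inE.
have [A2 B2] : #|A| = 2%N /\ #|B| = 2%N.
  by move: sumC cardAB; rewrite sumAB; move: #|A| #|B|; clear; lia.
have /eqP/cards2P[h1 [h2 [n12 eA]]] := A2.
have /eqP/cards2P[h3 [h4 [n34 eB]]] := B2.
have inA e : (e \in C) && t e = (e == h1) || (e == h2).
  by have /setP/(_ e) := eA; rewrite !inE.
have inB e : (e \in C) && ~~ t e = (e == h3) || (e == h4).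
  by have /setP/(_ e) := eB; rewrite !inE.
have := inA h1; have := inA h2; have := inB h3; have := inB h4.
rewrite !eqxx !orbT /= => /andP[_ t4] /andP[_ t3] /andP[_ t2] /andP[_ t1].
exists h1, h2, h3, h4; split; rewrite ?t1 ?t2 ?t3 ?t4 //.
  have diff h h' : t h -> ~~ t h' -> h != h' by move=> th; apply: contraNneq => <-.
  by rewrite /= !inE !negb_or n12 n34 !diff.
move=> e; rewrite !inE orbA -inA -inB.
by case: (e \in C); case: (t e).
Qed.

(** Induction on the number of vertices, with [X] of smallest size among the sets having a
4-edge cut.  For larger [X], the contraction of [X] is oriented by induction and
fixes a pattern on the cut: an orientation inside [X] with this pattern or the
reverse one is glued to it, and if there is none, the five copies contradict [H5]. *)
Lemma orientable3_of_5 :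
  (forall (V E : finType) (a b : E -> V), cut_connected 5 a b -> orientable3 a b) ->
  forall (V E : finType) (a b : E -> V), cut_connected 4 a b -> orientable3 a b.
Proof.
move=> H5 V; have [n] := ubnP #|V|; elim: n V => // n IHn V ltVn E a b con.
have {}IHn (V' E' : finType) (a' b' : E' -> V') : (#|V'| < #|V|)%N ->
    cut_connected 4 a' b' -> orientable3 a' b'.
  by move=> ltV'; apply: IHn; apply: leq_trans ltV' _.
pose P S := [&& S != set0, S != setT & cut a b S == 4%N].
have [/existsP[S0 PS0]|noP] := boolP [exists S, P S]; last first.
  apply: H5; case: con => V_gt0 con; split=> // S S0 ST.
  rewrite ltn_neqAle con // andbT eq_sym; apply: contraNN noP => cS.
  by apply/existsP; exists S; apply/and3P.
case: (arg_minnP (fun S : {set V} => #|S|) PS0) => X /and3P[X0 XT /eqP cX] Xmin.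
have X_min Y : Y != set0 -> Y \proper X -> (5 <= cut a b Y)%N.
  move=> Y0 YX; have YT : Y != setT.
    by apply: contraTneq YX => ->; rewrite properE subsetT andbF.
  case: con => _ con; rewrite ltn_neqAle con // andbT eq_sym.
  apply: contraTN (proper_card YX) => cY; rewrite -leqNgt; apply: Xmin.
  by apply/and3P.
have [/cards1P[v Xv]|X1] := boolP (#|X| == 1%N).
  by apply: (degree4_reduction (v := v) IHn con); rewrite -Xv.
have [a' [b' [ab' out]]] := outward_reorientation a b X.
have ab : reorients a' b' a b by move=> e; case: (ab' e) => -[-> ->]; auto.
apply: orientable3_reorients ab _.
have cutE S : cut a' b' S = cut a b S by apply: cut_reorients.
have {}con : cut_connected 4 a' b'.
  by case: con => ? con; split=> // S S0' ST; rewrite cutE; apply: con.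
have {}X_min Y : Y != set0 -> Y \proper X -> (5 <= cut a' b' Y)%N.
  by rewrite cutE; apply: X_min.
rewrite -cutE in cX.
move: a' b' {ab'} out con X_min cX {cutE} => {P S0 PS0 Xmin}a' b' out con X_min cX.
pose C := [set e | (a' e \in X) && (b' e \notin X)].
have C4 : #|C| = 4%N.
  rewrite -cX -sum1_card big_mkcond; apply: eq_bigr => e _; rewrite !inE.
  by have := out e; case: (a' e \in X); case: (b' e \in X) => //= /(_ isT).
have [t tP] : orientable3 (contract X \o a') (contract X \o b').
  apply: IHn; last exact: contract_connected.
  rewrite card_contract -(cardsC X).
  by move: X0 X1; rewrite -card_gt0; move: #|X| #|~: X|; clear; lia.
have [h1 [h2 [h3 [h4 [hs_uniq hsC /andP[t1 t2] /andP[t3 t4]]]]]] : exists h1 h2 h3 h4,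
   [/\ uniq [:: h1; h2; h3; h4], forall e, (e \in [:: h1; h2; h3; h4]) = (e \in C),
    t h1 && t h2 & ~~ t h3 && ~~ t h4].
  apply: two_and_two => //; have := tP None; rewrite contract_netflow_none //.
  by rewrite (eq_bigl (mem C)) // => e; rewrite !inE.
have hsP e : (e \in [:: h1; h2; h3; h4]) = (a' e \in X) && (b' e \notin X).
  by rewrite hsC inE.
pose Q (s : {ffun E -> bool}) :=
  [&& [forall x in X, (3 %| netflow a' b' (fun e => sgn (s e)) x)%Z],
      s h1 == s h2, s h3 == s h4 & s h1 != s h3].
have [/existsP[s /and4P[/forall_inP sP /eqP s12 /eqP s34 s13]]|noQ] := boolP [exists s, Q s].
  (* [t h1] is positive, so [s] is reversed if necessary to agree with [t] on the cut. *)
  apply: (glue_orientations (s := fun e => if s h1 then s e else ~~ s e) out _ tP).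
    move=> x xX; case: (s h1); first exact: sP.
    have -> : netflow a' b' (fun e => sgn (~~ s e)) x = - netflow a' b' (fun e => sgn (s e)) x.
      by rewrite /netflow -sumrN; apply: eq_bigr => e _; case: (s e); rewrite /sgn /=; ring.
    by rewrite rpredN; apply: sP.
  move=> e aX bX; have : e \in [:: h1; h2; h3; h4] by rewrite hsP aX bX.
  rewrite !inE => /or4P[] /eqP ->; rewrite -?s12 -?s34 ?t1 ?t2 ?(negbTE t3) ?(negbTE t4).
  - by case: (s h1).
  - by case: (s h1).
  - by move: s13; case: (s h1); case: (s h3).
  - by move: s13; case: (s h1); case: (s h3).
have [] := pentagon_not_orientable hs_uniq hsP out _ (H5 _ _ _ _ (pentagon_connected hs_uniq hsP X_min)).
move=> s sP s12 s34; apply/eqP; apply: contraNT noQ => s13.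
apply/existsP; exists [ffun e => s e]; apply/and4P; rewrite !ffunE s12 s34; split=> //; last by rewrite -s12 -s34.
apply/forall_inP => x xX; rewrite (_ : netflow _ _ _ _ = netflow a' b' (fun e => sgn (s e)) x) ?sP //.
by apply: eq_bigr => e _; rewrite ffunE.
Qed.

End ModuloThree.

Theorem mainTheorem5 :
  (forall G : multigraph, edge_connected 4 G -> has_nowhere_zero_3flow G) <->
  (forall G : multigraph, edge_connected 5 G -> min_degree_ge 6 G ->
     has_nowhere_zero_3flow G).
Proof.
split=> [flow4 G con _|flow56 G con].
  by apply: flow4 => S ltS; apply: con; apply: ltn_trans ltS _.
have [D] := orientation_exists G.
apply/(nowhere_zero_3flowP D); apply: orientable3_of_5; last exact/edge_connectedP.
exact: orientable3_of_5_6.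
Qed.
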